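(* Let $\mathbb{F}_q$ be a finite field with $q$ elements, $q$ odd, let $d\ge 3$ be an odd integer, and let $E\subset \mathbb{F}_q^d$. If $|E|\ge 6q^{d/2}$, then $$\{0\}\cup\mathbb{F}_q^+\subset\frac{\Delta(E)}{\Delta(E)}.$$
   Context: For $x=(x_1,\dots,x_d)\in\mathbb{F}_q^d$ put $\|x\|=x_1^2+\cdots+x_d^2\in\mathbb{F}_q$. For $E\subset\mathbb{F}_q^d$ the distance set is $\Delta(E)=\{\|x-y\|: x,y\in E\}\subset\mathbb{F}_q$, and its quotient set is $$\frac{\Delta(E)}{\Delta(E)}=\left\{\frac{a}{b}: a\in\Delta(E),\ b\in\Delta(E)\setminus\{0\}\right\}.$$ $\mathbb{F}_q^+$ denotes the set of nonzero quadratic residues (nonzero squares) in $\mathbb{F}_q$. *)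

(* Defs.v *)
From mathcomp Require Import all_boot all_order all_algebra.

Set Implicit Arguments.
Unset Strict Implicit.
Unset Printing Implicit Defensive.

Import GRing.Theory.
Local Open Scope ring_scope.

(* Takes values in F: not a norm in the metric sense. *)
Definition qnorm (F : finFieldType) (d : nat) (x : 'rV[F]_d) : F :=
  \sum_(i < d) x 0 i ^+ 2.

Definition dist_set (F : finFieldType) (d : nat) (E : {set 'rV[F]_d}) :
    {set F} :=
  [set qnorm (x - y) | x in E, y in E].

Definition quot_set (F : finFieldType) (A : {set F}) : {set F} :=
  [set a / b | a in A, b in A :\ 0].

Definition nz_squares (F : finFieldType) : {set F} :=
  [set x : F | (x != 0) && [exists y : F, x == y ^+ 2]].

(* Main.v *)
(* Write nu(t) for the number of pairs of E at distance t, and let r = s^2.  It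
   suffices that sum_t nu(r t) nu(t) > nu(0)^2.  With an additive character chi,
   S(t) = sum_{x, y in E} chi(t |x - y|) and h(a) = sum_m chi(a |m|) |E^(m)|^2,
   completing squares gives h(a) = g(a)^d S(-1/(4a)) for a <> 0, where g is the
   quadratic Gauss sum and |g(a)|^2 = q.
   - As g(a) = g(a/r), q sum_t nu(r t) nu(t) = sum_t S(t) conj(S(r t)) equals
     |E|^4 + q^-d sum_{a <> 0} h(a) conj(h(a/r)).  The sum over all a is
     nonnegative, so only the term h(0)^2 = q^(2d) |E|^2 can be lost.
   - As d is odd, g(a)^-d is a constant of modulus q^(-(d+1)/2) times g(a), and
     sum_{a <> 0} g(a) chi(a c) = q (#{x : x^2 = -c} - 1) has modulus at most q;
     hence q nu(0) <= |E|^2 + q^((d+1)/2) |E|. *)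

Require Import Defs.
From mathcomp Require Import all_boot all_order all_algebra.
From mathcomp Require Import fingroup action cyclic algC classfun character.
From mathcomp Require Import ring zify.
From mathcomp Require Import reals exp.

Set Implicit Arguments.
Unset Strict Implicit.
Unset Printing Implicit Defensive.

Import Order.TTheory GRing.Theory Num.Theory.
Local Open Scope ring_scope.

(** * Odd characteristic, additive characters and sums over vectors *)

(** If 2 = 0, the additive order of 1 divides the coprime numbers 2 and |F|, which forces 1 = 0. *)
Lemma odd_card_two_neq0 (F : finFieldType) : odd #|F| -> (2%:R : F) != 0.
Proof.
move=> oddF; apply/eqP=> two0.
have o2 : (#[1%R : F]%g %| 2)%N by rewrite order_dvdn FinRing.zmodXgE two0.
have oF : (#[1%R : F]%g %| #|F|)%N by rewrite -cardsT order_dvdG ?inE.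
have : (#[1%R : F]%g %| gcdn 2 #|F|)%N by rewrite dvdn_gcd o2 oF.
have /eqP -> : coprime 2 #|F| by rewrite coprime2n.
rewrite dvdn1 order_eq1; apply/negP; exact: oner_neq0.
Qed.

Lemma exists_nontrivial_addchar (F : finFieldType) :
  exists chi : F -> algC,
    [/\ {morph chi : x y / x + y >-> x * y},
        forall x, `|chi x| = 1,
        forall x, (chi x)^* = chi (- x)
      & exists x, chi x != 1].
Proof.
pose G := [set: F]%G.
have abG : abelian G by exact: FinRing.zmod_abelian.
have nG : (1 < Nirr G)%N.
  rewrite NirrE; move: (abG); rewrite card_classes_abelian => /eqP ->.
  by rewrite cardsT card_finNzRing_gt1.
(* Index 0 is the trivial character, so index 1 is a nontrivial one; it is linear because the group
   is abelian. *)
pose i : Iirr G := Ordinal nG.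
have lin : 'chi_i \is a linear_char by apply/char_abelianP.
exists (fun x => 'chi_i x); split.
- by move=> x y; rewrite -FinRing.zmodMgE lin_charM ?inE.
- by move=> x; rewrite normC_lin_char ?inE.
- by move=> x; rewrite -FinRing.zmodVgE lin_charV_conj ?inE.
apply/existsP; rewrite -negb_forall; apply/negP=> /forallP chi1.
suff: 'chi_i == 1 by rewrite irr_eq1.
apply/eqP/cfunP=> x; rewrite cfun1E inE; exact/eqP/chi1.
Qed.

(** Distributivity; it factors character sums over vectors into one-variable sums. *)
Lemma sum_rV_prod (R : comPzSemiRingType) (F : finType) (d : nat)
    (f : 'I_d -> F -> R) :
  \sum_(m : 'rV[F]_d) \prod_i f i (m 0 i) = \prod_i \sum_x f i x.
Proof.
rewrite bigA_distr_bigA /=.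
rewrite (reindex (fun u : {ffun 'I_d -> F} => \row_i u i)) /=.
  by apply: eq_bigr => u _; apply: eq_bigr => i _; rewrite mxE.
exists (fun m : 'rV[F]_d => [ffun i => m 0 i]) => [u | m] _.
  by apply/ffunP=> i; rewrite ffunE mxE.
by apply/rowP=> i; rewrite mxE ffunE.
Qed.

(** * Counting square roots in a finite field *)

Section SquareRoots.
Variable F : finFieldType.

(** In odd characteristic, this count minus 1 is the quadratic character of [y]. *)
Definition num_sqrt (y : F) : nat := #|[set x : F | x ^+ 2 == y]|.

Lemma num_sqrt_le2 y : (num_sqrt y <= 2)%N.
Proof.
rewrite /num_sqrt; case: (set_0Vmem [set x : F | x ^+ 2 == y]) => [-> | [z]].
  by rewrite cards0.
rewrite inE => /eqP <-; apply: (leq_trans _ (_ : #|[set z; - z]| <= 2)%N).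
  by apply/subset_leq_card/subsetP=> x; rewrite !inE eqf_sqr.
by rewrite cards2; case: (_ != _).
Qed.

Lemma num_sqrt0 : num_sqrt 0 = 1%N.
Proof.
rewrite /num_sqrt (_ : [set _ | _] = [set 0]) ?cards1 //.
by apply/setP=> x; rewrite !inE expf_eq0.
Qed.

Lemma num_sqrt_gt0 y : (0 < num_sqrt y)%N = [exists x, y == x ^+ 2].
Proof.
apply/card_gt0P/existsP=> -[x]; rewrite ?inE => /eqP e; exists x.
  by rewrite e.
by rewrite inE e.
Qed.

Lemma sum_sqr (V : nmodType) (f : F -> V) :
  \sum_x f (x ^+ 2) = \sum_y f y *+ num_sqrt y.
Proof.
rewrite (partition_big (fun x : F => x ^+ 2) predT) //=.
apply: eq_bigr => y _; rewrite (eq_bigr (fun=> f y)); last by move=> x /eqP ->.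
by rewrite sumr_const /num_sqrt cardsE.
Qed.

Lemma sum_num_sqrt : \sum_y num_sqrt y = #|F|.
Proof.
rewrite -sum1_card [RHS](partition_big (fun x : F => x ^+ 2) predT) //=.
by apply: eq_bigr => y _; rewrite sum1_card /num_sqrt cardsE.
Qed.

(* Each summand is at most 2 while the average over y is exactly 2. *)
Lemma num_sqrt_nonsquare (a y : F) :
  ~~ [exists x, a == x ^+ 2] -> (num_sqrt y + num_sqrt (y / a) = 2)%N.
Proof.
move=> nsq_a.
have a0 : a != 0.
  by apply: contra nsq_a => /eqP ->; apply/existsP; exists 0; rewrite expr0n.
have le2 z : (num_sqrt z + num_sqrt (z / a) <= 2)%N.
  have [-> | z0] := eqVneq z 0; first by rewrite mul0r num_sqrt0.
  have [/eqP -> | ] := boolP (num_sqrt z == 0)%N; first exact: num_sqrt_le2.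
  have [/eqP -> _ | ] := boolP (num_sqrt (z / a) == 0)%N.
    by rewrite addn0 num_sqrt_le2.
  (* If [z] and [z / a] both have roots, their quotient is a square root of [a]. *)
  rewrite -!lt0n !num_sqrt_gt0 => /existsP[u /eqP zau] /existsP[v /eqP zv].
  case/existsP: nsq_a; exists (v / u).
  by rewrite expr_div_n -zv -zau invf_div mulrC divfK.
have : (\sum_(z : F) (2 - (num_sqrt z + num_sqrt (z / a))) == 0)%N.
  rewrite sumnB; last by move=> z _; apply: le2.
  rewrite sum_nat_const big_split /= sum_num_sqrt.
  rewrite -(reindex_inj (mulIf (invr_neq0 a0)) (P := predT) (F := num_sqrt)).
  by rewrite /= sum_num_sqrt muln2 addnn subnn.
rewrite sum_nat_eq0 => /forallP/(_ y) /=; rewrite subn_eq0 => ge2.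
by apply/eqP; rewrite eqn_leq le2.
Qed.

End SquareRoots.

(** * Character orthogonality and quadratic Gauss sums *)

Section GaussSums.
Variables (F : finFieldType) (chi : F -> algC).
Hypothesis two_neq0 : (2%:R : F) != 0.
Hypothesis chiD : {morph chi : x y / x + y >-> x * y}.
Hypothesis normC_chi : forall x, `|chi x| = 1.
Hypothesis conjC_chi : forall x, (chi x)^* = chi (- x).
Hypothesis chi_nontrivial : exists x, chi x != 1.

Local Notation q := (#|F|).
Implicit Types (a b c r s t : F).

Lemma four_neq0 : (4%:R : F) != 0.
Proof. by rewrite (natrM _ 2 2) mulf_neq0. Qed.

Lemma chi_neq0 x : chi x != 0.
Proof. by rewrite -normr_eq0 normC_chi oner_eq0. Qed.

Lemma chi0 : chi 0 = 1.
Proof. by apply: (mulfI (chi_neq0 0)); rewrite -chiD addr0 mulr1. Qed.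

Lemma chi_sum (I : Type) (r : seq I) (P : pred I) (f : I -> F) :
  chi (\sum_(i <- r | P i) f i) = \prod_(i <- r | P i) chi (f i).
Proof. exact: (big_morph chi chiD chi0). Qed.

Lemma sum_chi : \sum_x chi x = 0.
Proof.
case: chi_nontrivial => z z1.
have : (chi z - 1) * (\sum_x chi x) = 0.
  rewrite mulrBl mul1r mulr_sumr [X in _ - X](reindex_inj (addrI z)) /=.
  by rewrite -sumrB big1 // => x _; rewrite chiD subrr.
by move/eqP; rewrite mulf_eq0 subr_eq0 (negPf z1) => /eqP.
Qed.

Lemma sum_chi_mul a : \sum_t chi (t * a) = (q * (a == 0))%:R.
Proof.
have [-> | a0] := eqVneq a 0.
  rewrite (eq_bigr (fun=> 1)) => [|t _]; last by rewrite mulr0 chi0.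
  by rewrite sumr_const muln1.
by rewrite muln0 -[LHS](reindex_inj (mulIf a0) (P := predT) (F := chi)) sum_chi.
Qed.

(** Expanding the product and summing over [t] first, orthogonality keeps only the terms with f1 u =
    f2 v. This serves both to count quadruples and to show that a dual sum is nonnegative. *)
Lemma sum_chi_double (T1 T2 : finType) (w1 : T1 -> algC) (w2 : T2 -> algC)
    (f1 : T1 -> F) (f2 : T2 -> F) :
  (forall v, w2 v \is Num.real) ->
  \sum_t (\sum_u w1 u * chi (t * f1 u)) * (\sum_v w2 v * chi (t * f2 v))^* =
  q%:R * \sum_u \sum_v w1 u * w2 v * (f1 u == f2 v)%:R.
Proof.
move=> w2R.
transitivity (\sum_t \sum_u \sum_v w1 u * w2 v * chi (t * (f1 u - f2 v))).
  apply: eq_bigr => t _; rewrite rmorph_sum mulr_suml; apply: eq_bigr => u _.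
  rewrite mulr_sumr; apply: eq_bigr => v _.
  rewrite rmorphM /= (CrealP (w2R v)) conjC_chi mulrBr chiD; ring.
rewrite exchange_big mulr_sumr; apply: eq_bigr => u _.
rewrite exchange_big mulr_sumr; apply: eq_bigr => v _.
by rewrite -mulr_sumr sum_chi_mul subr_eq0 natrM; ring.
Qed.

Definition gauss a : algC := \sum_x chi (a * x ^+ 2).

Lemma gauss_sqr a s : s != 0 -> gauss (a * s ^+ 2) = gauss a.
Proof.
move=> s0; rewrite /gauss [RHS](reindex_inj (mulfI s0)) /=.
by apply: eq_bigr => x _; congr chi; ring.
Qed.

Lemma conjC_gauss a : (gauss a)^* = gauss (- a).
Proof.
by rewrite rmorph_sum; apply: eq_bigr => x _; rewrite /= conjC_chi mulNr.
Qed.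

Lemma norm_gauss a : a != 0 -> gauss a * (gauss a)^* = q%:R.
Proof.
move=> a0; rewrite conjC_gauss /gauss mulr_sumr.
(* Substituting x = y + u makes the phase linear in [y], so summing over [y] kills every u <> 0. *)
transitivity (\sum_y \sum_u chi (a * u ^+ 2) * chi (y * (2%:R * a * u))).
  apply: eq_bigr => y _; rewrite mulr_suml (reindex_inj (addrI y)) /=.
  by apply: eq_bigr => u _; rewrite -!chiD; congr chi; ring.
rewrite exchange_big /= (bigD1 0) //= -mulr_sumr sum_chi_mul mulr0 eqxx muln1.
rewrite expr0n mulr0 chi0 mul1r big1 ?addr0 // => u u0.
by rewrite -mulr_sumr sum_chi_mul !mulf_eq0 (negPf two_neq0) (negPf a0)
           (negPf u0) muln0 mulr0.
Qed.

Lemma gauss_neq0 a : a != 0 -> gauss a != 0.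
Proof.
move=> /norm_gauss; apply: contra_eqN => /eqP ->.
by rewrite mul0r eq_sym pnatr_eq0 -lt0n; apply/card_gt0P; exists 0.
Qed.

(** For a nonsquare [a], the values x^2 and a x^2 together cover each element twice, so gauss 1 +
    gauss a = 2 sum_y chi(y) = 0. *)
Lemma gauss_squared a : a != 0 -> gauss a ^+ 2 = gauss 1 ^+ 2.
Proof.
move=> a0; have [/existsP[s /eqP as2] | nsq_a] := boolP [exists x, a == x ^+ 2].
  rewrite as2 -[s ^+ 2]mul1r gauss_sqr //.
  by apply: contra_neq a0 => s0; rewrite as2 s0 expr0n.
suff -> : gauss a = - gauss 1 by rewrite sqrrN.
apply/eqP; rewrite -addr_eq0 addrC /gauss.
rewrite (eq_bigr _ (fun x _ => congr1 chi (mul1r _))) (sum_sqr chi).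
rewrite (sum_sqr (fun y => chi (a * y))).
rewrite [X in _ + X](reindex_inj (mulIf (invr_neq0 a0))) /=.
rewrite -big_split (eq_bigr (fun y => chi y *+ 2)) /=.
  by rewrite sumrMnl sum_chi mul0rn.
by move=> y _; rewrite mulrC divfK // -mulrnDr num_sqrt_nonsquare.
Qed.

Lemma sum_chi_quadratic a b : a != 0 ->
  \sum_x chi (a * x ^+ 2 + b * x) = chi (- (b ^+ 2 / (4%:R * a))) * gauss a.
Proof.
move=> a0; rewrite /gauss mulr_sumr.
rewrite (reindex_inj (addIr (- (b / (2%:R * a))))) /=.
by apply: eq_bigr => x _; rewrite -chiD; congr chi; field; rewrite a0 four_neq0.
Qed.

(** Summing over all [a] detects x^2 = -c; the excluded term a = 0 is gauss 0 = q, which accounts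
    for the -1. *)
Lemma sum_gauss_chi c :
  \sum_(a | a != 0) gauss a * chi (a * c) = q%:R * ((num_sqrt (- c))%:R - 1).
Proof.
have g0 : gauss 0 = q%:R.
  rewrite /gauss (eq_bigr (fun=> 1)) ?sumr_const // => x _.
  by rewrite mul0r chi0.
have -> : \sum_(a | a != 0) gauss a * chi (a * c)
        = \sum_a gauss a * chi (a * c) - q%:R.
  by rewrite [in RHS](bigD1 0) //= mul0r chi0 g0 mulr1 addrC addrK.
rewrite mulrBr mulr1; congr (_ - _).
transitivity (\sum_x \sum_a chi (a * (x ^+ 2 + c))).
  rewrite exchange_big; apply: eq_bigr => a _; rewrite mulr_suml.
  by apply: eq_bigr => x _; rewrite -chiD mulrDr.
rewrite (eq_bigr _ (fun x _ => sum_chi_mul _)) -natr_sum -big_distrr natrM.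
congr (_ * _%:R); rewrite /num_sqrt -sum1_card [RHS]big_mkcond /=.
by apply: eq_bigr => x _; rewrite inE addr_eq0; case: (_ == _).
Qed.

(** * Fourier analysis of the distances in [E] *)

Section DistanceCounts.
Variables (d : nat) (E : {set 'rV[F]_d}).

Local Notation n := (#|E|).

Definition dotp (m x : 'rV[F]_d) : F := \sum_i m 0 i * x 0 i.

Lemma sum_chi_qnorm a x : a != 0 ->
  \sum_m chi (a * qnorm m + dotp m x) =
  gauss a ^+ d * chi (- (4%:R * a)^-1 * qnorm x).
Proof.
move=> a0.
transitivity (\prod_(i < d) \sum_y chi (a * y ^+ 2 + x 0 i * y)).
  rewrite -sum_rV_prod; apply: eq_bigr => m _; rewrite -chi_sum; congr chi.
  rewrite /qnorm mulr_sumr -big_split /=; apply: eq_bigr => i _.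
  by rewrite [_ * x _ _]mulrC.
rewrite (eq_bigr _ (fun i _ => sum_chi_quadratic _ a0)) big_split /=.
rewrite prodr_const card_ord mulrC -chi_sum; congr (_ * chi _).
by rewrite /qnorm mulr_sumr; apply: eq_bigr => i _; rewrite mulNr mulrC.
Qed.

Lemma sum_chi_dotp x : \sum_m chi (dotp m x) = (q ^ d * (x == 0))%:R.
Proof.
transitivity (\prod_(i < d) \sum_y chi (y * x 0 i)).
  by rewrite -sum_rV_prod; apply: eq_bigr => m _; rewrite -chi_sum.
rewrite (eq_bigr _ (fun i _ => sum_chi_mul _)).
have [-> | /rV0Pn[i xi0]] := eqVneq x 0.
  rewrite (eq_bigr (fun=> q%:R)) => [|i _]; last by rewrite mxE eqxx muln1.
  by rewrite prodr_const card_ord muln1 natrX.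
by rewrite (bigD1 i) //= (negPf xi0) !muln0 mul0r.
Qed.

Definition edist (p : 'rV[F]_d * 'rV[F]_d) : F := qnorm (p.1 - p.2).

(** This is S(t) in the notation above, and [dual_sum] is h. *)
Definition dist_sum t : algC := \sum_(p in setX E E) chi (t * edist p).

(** Squared modulus of the unnormalised Fourier transform of the indicator of [E]. *)
Definition energy (m : 'rV[F]_d) : algC := `|\sum_(x in E) chi (dotp m x)| ^+ 2.

Definition dual_sum a : algC := \sum_m energy m * chi (a * qnorm m).

Lemma energyE m : energy m = \sum_(p in setX E E) chi (dotp m (p.1 - p.2)).
Proof.
rewrite /energy normCK rmorph_sum mulr_suml.
rewrite (eq_bigl (fun p => (p.1 \in E) && (p.2 \in E))); last first.
  by case=> x y; rewrite in_setX.
rewrite -(pair_big (mem E) (mem E) (fun x y => chi (dotp m (x - y)))) /=.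
apply: eq_bigr => x _; rewrite mulr_sumr; apply: eq_bigr => y _.
rewrite conjC_chi -chiD -sumrN -big_split /=; congr chi; apply: eq_bigr => i _.
by rewrite !mxE mulrBr.
Qed.

Lemma energy_ge0 m : 0 <= energy m.
Proof. exact: exprn_ge0. Qed.

Lemma dual_sumE a : a != 0 ->
  dual_sum a = gauss a ^+ d * dist_sum (- (4%:R * a)^-1).
Proof.
move=> a0; rewrite /dual_sum /dist_sum mulr_sumr.
transitivity (\sum_m \sum_(p in setX E E)
                chi (a * qnorm m + dotp m (p.1 - p.2))).
  apply: eq_bigr => m _; rewrite energyE mulr_suml; apply: eq_bigr => p _.
  by rewrite -chiD addrC.
by rewrite exchange_big; apply: eq_bigr => p _; rewrite /= sum_chi_qnorm.
Qed.

(** Plancherel: summing over [m] leaves only the diagonal pairs. *)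
Lemma sum_energy : \sum_m energy m = (q ^ d * n)%:R.
Proof.
rewrite (eq_bigr _ (fun m _ => energyE m)) exchange_big /=.
rewrite (eq_bigr _ (fun p _ => sum_chi_dotp _)) -natr_sum -big_distrr /=.
congr (_ * _)%:R; rewrite -sum1_card.
rewrite (eq_bigl (fun p => (p.1 \in E) && (p.2 \in E))); last first.
  by case=> x y; rewrite in_setX.
rewrite -(pair_big (mem E) (mem E) (fun x y => nat_of_bool (x - y == 0))) /=.
apply: eq_bigr => x xE; rewrite (bigD1 x) //= subrr eqxx big1 // => y /andP[_ yx].
by rewrite subr_eq0 eq_sym (negPf yx).
Qed.

Lemma dual_sum0 : dual_sum 0 = (q ^ d * n)%:R.
Proof.
by rewrite -sum_energy; apply: eq_bigr => m _; rewrite mul0r chi0 mulr1.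
Qed.

Lemma dist_sum0 : dist_sum 0 = (n ^ 2)%:R.
Proof.
rewrite /dist_sum (eq_bigr (fun=> 1)) => [|p _]; last by rewrite mul0r chi0.
by rewrite sumr_const cardsX mulnn.
Qed.

(** The map t -> -1/(4t) is its own inverse, so [dual_sumE] can be solved for [dist_sum]. *)
Lemma dist_sumE t : t != 0 ->
  dist_sum t = dual_sum (- (4%:R * t)^-1) / gauss (- (4%:R * t)^-1) ^+ d.
Proof.
move=> t0.
have a0 : - (4%:R * t)^-1 != 0 by rewrite oppr_eq0 invr_eq0 mulf_neq0 ?four_neq0.
rewrite dual_sumE // mulrC mulKf ?expf_neq0 ?gauss_neq0 //.
by congr dist_sum; field; rewrite t0 four_neq0 oppr_eq0 oner_eq0.
Qed.

Lemma reindex_neg_inv_4 (f : F -> algC) :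
  \sum_(t | t != 0) f (- (4%:R * t)^-1) = \sum_(t | t != 0) f t.
Proof.
(* With the convention 0^-1 = 0 the map is injective on all of [F] and fixes 0. *)
have inj : injective (fun t : F => - (4%:R * t)^-1).
  by move=> s t /oppr_inj/invr_inj/(mulfI four_neq0).
rewrite [RHS](reindex_inj inj) /=; apply: eq_bigl => t.
by rewrite oppr_eq0 invr_eq0 mulf_eq0 (negPf four_neq0).
Qed.

Definition zero_pairs := [set p in setX E E | edist p == 0].

(** Its cardinality is sum_t nu(r t) nu(t). Quadruples with both distances zero are included and
    number nu(0)^2. *)
Definition scaled_pairs (r : F) :=
  [set u in setX (setX E E) (setX E E) | edist u.1 == r * edist u.2].

Lemma scaled_pairs_ge (s : F) : s != 0 ->
  (n ^ 4 <= q * #|scaled_pairs (s ^+ 2)| + q ^ d * n ^ 2)%N.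
Proof.
move=> s0; set r := s ^+ 2; have r0 : r != 0 by rewrite expf_neq0.
have q0 : (q%:R : algC) != 0.
  by rewrite pnatr_eq0 -lt0n; apply/card_gt0P; exists 0.
pose ind (p : 'rV[F]_d * 'rV[F]_d) : algC := (p \in setX E E)%:R.
have dist_sum_ind (c t : F) :
    dist_sum (t * c) = \sum_p ind p * chi (t * (c * edist p)).
  rewrite /dist_sum big_mkcond; apply: eq_bigr => p _; rewrite /ind.
  by case: ifP => _; rewrite ?mul0r // mul1r mulrA.
have count : \sum_t dist_sum t * (dist_sum (t * r))^* =
    (q * #|scaled_pairs r|)%:R.
  have indR p : ind p \is Num.real by apply: realn.
  transitivity (\sum_t (\sum_p ind p * chi (t * edist p)) *
      (\sum_p ind p * chi (t * (r * edist p)))^*).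
    apply: eq_bigr => t _; rewrite dist_sum_ind -{1}[t]mulr1 dist_sum_ind.
    by under [X in X * _]eq_bigr do rewrite mul1r.
  rewrite sum_chi_double // natrM; congr (_ * _).
  rewrite pair_bigA -sum1_card natr_sum [RHS]big_mkcond /=.
  apply: eq_bigr => -[p p'] _ /=; rewrite /ind.
  rewrite [_ \in scaled_pairs r]in_set in_setX /=.
  by case: (_ \in _); case: (_ \in _); case: (_ == _); rewrite ?mulr1 ?mulr0 ?mul0r.
(* By orthogonality this is q times a sum of products of energies. *)
have dual_ge0 : 0 <= \sum_a dual_sum a * (dual_sum (a / r))^*.
  rewrite (eq_bigr (fun a => (\sum_m energy m * chi (a * qnorm m)) *
      (\sum_m energy m * chi (a * (qnorm m / r)))^*)); last first.
    move=> a _; congr (_ * (_)^*); apply: eq_bigr => m _.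
    by congr (_ * chi _); ring.
  rewrite sum_chi_double => [|m]; last exact/ger0_real/energy_ge0.
  apply: mulr_ge0 => //; apply: sumr_ge0 => u _; apply: sumr_ge0 => v _.
  by rewrite !mulr_ge0 ?energy_ge0 // ler0n.
have tail : \sum_(t | t != 0) dist_sum t * (dist_sum (t * r))^* =
    \sum_(a | a != 0) dual_sum a * (dual_sum (a / r))^* / q%:R ^+ d.
  rewrite -[RHS]reindex_neg_inv_4; apply: eq_bigr => t t0.
  have tr0 : t * r != 0 by rewrite mulf_neq0.
  have -> : - (4%:R * t)^-1 / r = - (4%:R * (t * r))^-1.
    by rewrite mulNr -invfM mulrA.
  rewrite (dist_sumE t0) (dist_sumE tr0).
  set a := - (4%:R * t)^-1; set b := - (4%:R * (t * r))^-1.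
  have b0 : b != 0 by rewrite oppr_eq0 invr_eq0 mulf_neq0 ?four_neq0.
  (* Since a = b s^2, the two Gauss factors are conjugate and multiply to |g(b)|^(2d) = q^d. *)
  have -> : gauss a = gauss b.
    rewrite -(gauss_sqr b s0); congr gauss; rewrite /a /b -/r.
    by field; rewrite t0 r0 four_neq0.
  rewrite rmorphM fmorphV rmorphXn /= -(norm_gauss b0) exprMn invfM.
  ring.
have : (n ^ 4)%:R <= (q * #|scaled_pairs r|)%:R + (q ^ d * n ^ 2)%:R :> algC.
  rewrite -count (bigD1 0) //= mul0r dist_sum0 conjC_nat tail -mulr_suml.
  move: dual_ge0; rewrite (bigD1 0) //= mul0r dual_sum0 conjC_nat.
  set T := \sum_(_ | _) _ => T_ge.
  (* The added q^d n^2 is the a = 0 term (q^d n)^2 over q^d; it completes [T] to the full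
     nonnegative sum. *)
  have -> : (n ^ 2)%:R * (n ^ 2)%:R + T / q%:R ^+ d + (q ^ d * n ^ 2)%:R =
     (n ^ 4)%:R + ((q ^ d * n)%:R * (q ^ d * n)%:R + T) / q%:R ^+ d :> algC.
    rewrite !(natrM, natrX); field; rewrite expf_neq0 //.
  by rewrite lerDl divr_ge0 // exprn_ge0.
by rewrite -natrD ler_nat.
Qed.

Lemma zero_pairs_le : odd d ->
  (q * #|zero_pairs| <= n ^ 2 + q ^ (d./2).+1 * n)%N.
Proof.
move=> odd_d.
(* The difference is the sum of S(t) over t <> 0, estimated in modulus. *)
suff: `|(q * #|zero_pairs|)%:R - (n ^ 2)%:R| <= (q ^ (d./2).+1 * n)%:R :> algC.
  rewrite real_ler_distl ?realB ?realn // => /andP[_].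
  by rewrite -natrD ler_nat.
have q0 : (q%:R : algC) != 0.
  by rewrite pnatr_eq0 -lt0n; apply/card_gt0P; exists 0.
have norm_c : `|gauss 1 ^+ 2| = q%:R.
  by rewrite normrX normCK norm_gauss // oner_eq0.
have dE : d = (d./2).*2.+1 by rewrite -[LHS]odd_double_half odd_d.
have count : (q * #|zero_pairs|)%:R = \sum_t dist_sum t.
  rewrite /dist_sum exchange_big (eq_bigr _ (fun p _ => sum_chi_mul _)) /=.
  rewrite -natr_sum -big_distrr /=; congr (_ * _)%:R.
  rewrite -sum1_card big_mkcond [RHS]big_mkcond /=.
  by apply: eq_bigr => p _; rewrite inE; case: (_ \in _); case: (_ == _).
(* For d = 2k + 1, g(a)^-d = g(a) / (g(a)^2)^(k+1), and g(a)^2 does not depend on [a]. *)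
have gauss_pow a : a != 0 ->
    (gauss a ^+ d)^-1 = (gauss 1 ^+ 2) ^- (d./2).+1 * gauss a.
  move=> a0; have g0 := gauss_neq0 a0.
  rewrite -(gauss_squared a0) -exprM mul2n; move: dE; generalize d./2 => k ->.
  by rewrite doubleS [in RHS]exprSr invfM divfK.
rewrite count (bigD1 0) //= dist_sum0 [_%:R + _]addrC addrK.
rewrite (eq_bigr _ dist_sumE).
rewrite (reindex_neg_inv_4 (fun a => dual_sum a / gauss a ^+ d)).
have -> : \sum_(a | a != 0) dual_sum a / gauss a ^+ d =
    (gauss 1 ^+ 2) ^- (d./2).+1 *
    \sum_m energy m * (q%:R * ((num_sqrt (- qnorm m))%:R - 1)).
  rewrite (eq_bigr (fun a => (gauss 1 ^+ 2) ^- (d./2).+1 *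
      \sum_m energy m * (gauss a * chi (a * qnorm m)))); last first.
    move=> a a0; rewrite gauss_pow // mulrCA; congr (_ * _).
    by rewrite /dual_sum mulr_suml; apply: eq_bigr => m _; ring.
  rewrite -mulr_sumr exchange_big /=; congr (_ * _); apply: eq_bigr => m _.
  by rewrite -mulr_sumr sum_gauss_chi.
rewrite normrM normfV normrX norm_c.
rewrite mulrC ler_pdivrMr ?exprn_gt0 ?ltr0n ?lt0n -?(pnatr_eq0 algC) //.
apply: le_trans (ler_norm_sum _ _ _) _.
apply: (le_trans (_ : _ <= \sum_m energy m * q%:R)).
  apply: ler_sum => m _; rewrite normrM (ger0_norm (energy_ge0 m)) normrM normr_nat.
  apply: ler_wpM2l; first exact: energy_ge0.
  rewrite ler_piMr ?ler0n //.
  (* The number of roots minus 1 is -1, 0 or 1. *)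
  case: (num_sqrt _) (num_sqrt_le2 (- qnorm m)) => [|[|[|]]] // _.
  - by rewrite sub0r normrN1.
  - by rewrite subrr normr0 ler01.
  - by rewrite (natrD _ 1 1) addrK normr1.
rewrite -mulr_suml sum_energy -natrX -!natrM ler_nat.
have -> : (q ^ d = q ^ (d./2).*2.+1)%N by rewrite -dE.
rewrite -addnn !expnS expnD; apply: eq_leq; ring.
Qed.

End DistanceCounts.
End GaussSums.

(** * From the two Fourier bounds to the quotient set *)

Lemma powR_half_sqr (R : realType) (x : R) (d : nat) : 0 <= x ->
  (x `^ (d%:R / 2)) ^+ 2 = x ^+ d.
Proof.
move=> x0; rewrite -powR_mulrn ?powR_ge0 //.
by rewrite -powRrM divfK ?pnatr_eq0 // powR_mulrn.
Qed.

(** Put m = n^2 and B = q^(k+1) n, so that 36 B^2 <= q m^2. If N <= v^2, then 35 q m^2 <= 36 (q v)^2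
    <= 72 (m^2 + B^2) <= 72 m^2 + 2 q m^2, so 33 q <= 72, contrary to q >= 3. *)
Lemma sqr_lt_of_fourier_bounds (q n k v N : nat) :
  (3 <= q)%N -> (0 < n)%N -> (36 * q ^ k.*2.+1 <= n ^ 2)%N ->
  (n ^ 4 <= q * N + q ^ k.*2.+1 * n ^ 2)%N ->
  (q * v <= n ^ 2 + q ^ k.+1 * n)%N ->
  (v ^ 2 < N)%N.
Proof.
move=> q3 n0 nD nN vB; rewrite ltnNge; apply/negP=> Nv.
have BE : ((q ^ k.+1 * n) ^ 2 = q * q ^ k.*2.+1 * n ^ 2)%N.
  by rewrite expnMn -expnM -expnS; congr (q ^ _ * _)%N; lia.
move: BE nD nN vB; set B := (q ^ k.+1 * n)%N; set D := (q ^ k.*2.+1)%N.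
rewrite (_ : n ^ 4 = n ^ 2 * n ^ 2)%N; last by rewrite -expnD.
have : (0 < n ^ 2)%N by rewrite expn_gt0 n0.
move: (n ^ 2)%N => m m0 BE nD nN vB.
have qB : (36 * B ^ 2 <= q * (m * m))%N.
  rewrite BE; have := leq_mul (leqnn q) (leq_mul nD (leqnn m)); lia.
have qm : (35 * q * (m * m) <= 36 * (q * v) ^ 2)%N.
  have := leq_mul (leqnn (36 * q)) nN.
  have := leq_mul (leqnn q) (leq_mul nD (leqnn m)).
  have := leq_mul (leqnn (36 * q * q)) Nv; rewrite expnMn; lia.
have le1 : ((q * v) ^ 2 <= (m + B) ^ 2)%N by rewrite leq_sqr.
have le2 : ((m + B) ^ 2 <= 2 * (m * m + B ^ 2))%N.
  by rewrite sqrnD; have := (nat_Cauchy m B).1; rewrite mulnn; lia.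
have le3 : (3 * (m * m) <= q * (m * m))%N by rewrite leq_mul2r q3 orbT.
have : (0 < m * m)%N by rewrite muln_gt0 m0.
lia.
Qed.

Lemma sqr_mem_quot_dist_set (F : finFieldType) (d : nat) (E : {set 'rV[F]_d})
    (s : F) :
  odd #|F| -> odd d -> (0 < #|E|)%N -> (36 * #|F| ^ d <= #|E| ^ 2)%N ->
  s != 0 ->
  exists a b, [/\ a \in dist_set E, b \in dist_set E, b != 0 & a = s ^+ 2 * b].
Proof.
move=> oddF odd_d E0 large s0.
have two_neq0 := odd_card_two_neq0 oddF.
have [chi [chiD norm_chi conj_chi chi_nt]] := exists_nontrivial_addchar F.
have dE : d = (d./2).*2.+1 by rewrite -[LHS]odd_double_half odd_d.
have F3 : (3 <= #|F|)%N.
  by have := card_finNzRing_gt1 F; move: oddF; case: #|F| => [|[|[|]]].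
have ge := scaled_pairs_ge two_neq0 chiD norm_chi conj_chi chi_nt E s0.
have dev := zero_pairs_le two_neq0 chiD norm_chi conj_chi chi_nt E odd_d.
have : (#|zero_pairs E| ^ 2 < #|scaled_pairs E (s ^+ 2)|)%N.
  by apply: sqr_lt_of_fourier_bounds dev => //; rewrite -dE.
rewrite -mulnn -cardsX => lt.
(* There are too many quadruples for all to consist of two pairs at distance zero. In one that does
   not, [edist (z, w) = 0] would force both distances to vanish. *)
have /subsetPn[[[x y] [z w]]] :
    ~~ (scaled_pairs E (s ^+ 2) \subset setX (zero_pairs E) (zero_pairs E)).
  by apply/negP=> /subset_leq_card; rewrite leqNgt lt.
rewrite inE /= !in_setX => /andP[/andP[/andP[xE yE] /andP[zE wE]] /eqP xyzw].
move=> notzero; exists (edist (x, y)), (edist (z, w)); split => //.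
- by apply/imset2P; exists x y.
- by apply/imset2P; exists z w.
apply: contra notzero => /eqP zw0.
by rewrite !inE /= xE yE zE wE xyzw zw0 mulr0 eqxx.
Qed.

Theorem theorem1p2 (R : realType) (F : finFieldType) (d : nat)
    (E : {set 'rV[F]_d}) :
  odd #|F| -> (3 <= d)%N -> odd d ->
  6 * (#|F|%:R : R) `^ (d%:R / 2) <= #|E|%:R ->
  0 |: nz_squares F \subset quot_set (dist_set E).
Proof.
move=> oddF _ odd_d large.
have F0 : (0 < #|F|)%N by apply/card_gt0P; exists 0.
(* Squaring the size hypothesis removes the exponent d/2 and turns 6 into 36. *)
have largeN : (36 * #|F| ^ d <= #|E| ^ 2)%N.
  rewrite -(ler_nat R) natrM !natrX -(powR_half_sqr d) ?ler0n //.
  rewrite (_ : 36%:R = 6 ^+ 2 :> R) -?exprMn; last by rewrite -natrX.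
  by rewrite lerXn2r ?nnegrE ?mulr_ge0 ?powR_ge0 ?ler0n.
have E0 : (0 < #|E|)%N.
  rewrite -(ltn_exp2r _ _ (isT : 0 < 2)%N) (leq_trans _ largeN) //.
  by rewrite muln_gt0 expn_gt0 F0.
have [x xE] := card_gt0P E0.
apply/subsetP=> r; rewrite !inE => /orP[/eqP -> | /andP[r0 /existsP[s /eqP rs]]].
  (* The ratio 0 needs a nonzero distance [b], supplied by s = 1, under the distance from [x] to
     itself. *)
  have [_ [b [_ bE b0 _]]] :=
    sqr_mem_quot_dist_set oddF odd_d E0 largeN (oner_neq0 F).
  apply/imset2P; exists 0 b; rewrite ?inE ?b0 ?mul0r //.
  apply/imset2P; exists x x => //.
  by rewrite subrr /qnorm big1 // => i _; rewrite mxE expr0n.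
have s0 : s != 0 by apply: contra_neq r0 => s0; rewrite rs s0 expr0n.
have [a [b [aE bE b0 ab]]] := sqr_mem_quot_dist_set oddF odd_d E0 largeN s0.
by apply/imset2P; exists a b; rewrite ?inE ?b0 // ab mulfK.
Qed.
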